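(* Let $0<\lambda<\mu_2<\mu_1$, $\rho_2=\lambda/\mu_2$, and let $z\in[\rho_2,1)$. Let $\mathbf{w}=(w_0,w_1,\dots)$ be defined by $w_0=1$, $\mu_1w_1=(\lambda+\mu_2(1-z))z$, and $$\mu_1w_{k+1}=(\lambda+\mu_1+\mu_2(1-z))z\,w_k-\lambda z\,w_{k-1},\qquad k\ge1,$$ and define $\tilde\lambda_0=\mu_2z$ and $\tilde\lambda_i=\tilde\lambda_{i-1}\frac{w_{i-1}}{w_i}+\mu_2z-\mu_1$ for $i\ge1$. Consider the tandem Jackson network with infinite waiting room at the first queue, modified so that, when the second queue is empty and there are $i$ customers in the first queue, the arrival rate to the first queue is $\tilde\lambda_i$ instead of $\lambda$ (all other transition rates unchanged). Then the stationary distribution $\boldsymbol{\pi}=(\boldsymbol{\pi}_0,\boldsymbol{\pi}_1,\dots)$ of this modified process, where $\boldsymbol{\pi}_n=(\pi_{n0},\pi_{n1},\dots)$ collects the stationary probabilities of $n$ customers in queue 2 and $0,1,\dots$ customers in queue 1, is given by $$\boldsymbol{\pi}_n=c\,z^n\,\mathbf{w},\qquad n\ge0,$$ for some normalizing constant $c$. In particular the decay rate of the stationary distribution of the second queue is $z$.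
   Context: The modified process is the continuous-time Markov chain on $\{(k,j):k,j\ge0\}$ ($k$ customers in queue 2, $j$ in queue 1) with transitions: $(k,j)\to(k,j+1)$ at rate $\lambda$ if $k\ge1$ and at rate $\tilde\lambda_j$ if $k=0$; $(k,j)\to(k+1,j-1)$ at rate $\mu_1$ for $j\ge1$; $(k,j)\to(k-1,j)$ at rate $\mu_2$ for $k\ge1$. *)

(* Defs.v *)
From mathcomp Require Export all_boot all_order all_algebra.
From mathcomp Require Export all_classical all_reals all_analysis.

Set Implicit Arguments.
Unset Strict Implicit.
Unset Printing Implicit Defensive.

Export Order.TTheory GRing.Theory Num.Theory.
Export numFieldNormedType.Exports.

#[global] Open Scope classical_set_scope.
#[global] Open Scope ring_scope.

Definition is_distribution (R : realType) (T : countType) (p : T -> R) : Prop :=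
  (forall i, 0 <= p i) /\
  (\esum_(i in [set: T]) (p i)%:E = 1%:E)%E.

(* [P t i j] is the probability of being in [j] at time [s + t] given that the
   chain is in [i] at time [s], and [q i j] (for [i != j]) is the rate of the
   transition from [i] to [j]; diagonal values of [q] are ignored.  The last
   clause says that the total rate out of [i] is the sum of the rates of the
   individual transitions out of [i].  [q i j >= 0] for [i != j] is forced by
   the fourth clause, so the sum in the fifth one is a genuine sum of
   nonnegative terms. *)
Record is_CTMC (R : realType) (T : countType) (q : T -> T -> R)
    (P : R -> T -> T -> R) : Prop := IsCTMC {
  CTMC_distribution : forall (t : R) i, 0 <= t -> is_distribution (P t i);
  CTMC_initial : forall i j, P 0 i j = (i == j)%:R;
  CTMC_Chapman_Kolmogorov : forall (s t : R) i j, 0 <= s -> 0 <= t ->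
    ((P (s + t) i j)%:E = \esum_(k in [set: T]) (P s i k * P t k j)%:E)%E;
  CTMC_rate : forall i j, i != j ->
    P h i j / h @[h --> 0^'+] --> q i j;
  CTMC_exit_rate : forall i,
    ((1 - P h i i) / h)%:E @[h --> 0^'+] -->
      (\esum_(j in [set j | j != i]) (q i j)%:E)%E }.

Definition is_stationary (R : realType) (T : countType) (P : R -> T -> T -> R)
    (pi : T -> R) : Prop :=
  is_distribution pi /\
  forall (t : R) j, 0 <= t ->
    (\esum_(i in [set: T]) (pi i * P t i j)%:E = (pi j)%:E)%E.

(* A state is a pair [(k, j)]: [k] customers in queue 2 and [j] customers in
   queue 1.  At most one of the three summands is nonzero. *)
Definition tandem_rate (R : realType) (lam mu1 mu2 : R) (lamt : nat -> R)
    (x y : nat * nat) : R :=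
  let: (k, j) := x in
    (if k == 0%N then lamt j else lam) *+ (y == (k, j.+1))
  + mu1 *+ ((0 < j)%N && (y == (k.+1, j.-1)))
  + mu2 *+ ((0 < k)%N && (y == (k.-1, j))).

Definition queue2_marginal (R : realType) (pi : nat * nat -> R) (n : nat) : R :=
  fine (\esum_(j in [set: nat]) (pi (n, j))%:E)%E.

Definition has_decay_rate (R : realType) (p : nat -> R) (z : R) : Prop :=
  (forall n, 0 < p n) /\ p n.+1 / p n @[n --> \oo] --> z.

(* Main.v *)
Require Import Defs.
From mathcomp Require Import ring lra.

(** The measure [mu (n, j) = c * z ^+ n * w j] satisfies the global balance
    equations: at states where queue 2 is nonempty they are the recurrence
    that defines [w], and at states where it is empty they are the recursion
    that defines [lamt].  What remains is to see that the weights and rates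
    make sense, and that balance determines the stationary distribution of
    every Markov process with these rates.

    Weights: the ratio of consecutive weights stays between [w 1] and 1
    ([weight_ratio]), and [lamt i] is an affine function of [w i.+1 / w i]
    ([lamt_weight]), so the rates are positive and bounded.  The recursion of
    [lamt] telescopes, and gives the sum [mu1 / (mu1 - mu2 * z)] of the weights
    ([esum_weight]), hence the normalizing constant.

    Existence: all exit rates are bounded, so a Markov process is obtained by
    uniformization, i.e. by running a discrete chain at the times of a Poisson
    process ([bounded_rates_CTMC]).

    Stationarity ([CTMC_balance_stationary]) is proved for an arbitrary process
    with the given rates, without differential equations.  A step of length [h]
    moves at least the balanced flow, up to a defect of total mass [o(h)]; in
    [t / h] steps a mass at most [o(1)] is lost, so [mu] lies below its image
    at time [t], and equality follows since both have mass 1.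

    Uniqueness ([CTMC_stationary_unique]): the minimum of two stationary
    distributions is invariant, and an invariant measure of an irreducible chain
    is zero or positive everywhere.  The chain is irreducible because all rates
    of the possible transitions are positive ([tandem_irreducible]). *)

Set Implicit Arguments.
Unset Strict Implicit.
Unset Printing Implicit Defensive.

(** * Sums of nonnegative families *)

Section esum_lemmas.
Variables (R : realType).
Local Open Scope ereal_scope.

Lemma esumZl (T : choiceType) (S : set T) (a : R) (f : T -> \bar R) : (0 <= a)%R ->
  (forall i, S i -> 0 <= f i) ->
  \esum_(i in S) (a%:E * f i) = a%:E * \esum_(i in S) f i.
Proof.
move=> a0; wlog {S} -> : S f / S = setT.
  move=> h f0; rewrite esum_mkcond [in RHS]esum_mkcond -h//.
    by apply: eq_esum => i _; case: ifPn => //; rewrite mule0.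
  by move=> i _; case: ifPn => // /[!inE] /f0.
move=> f0.
have le (b : R) (g : T -> \bar R) : (0 <= b)%R -> (forall i, 0 <= g i) ->
    \esum_(i in [set: T]) (b%:E * g i) <= b%:E * \esum_(i in [set: T]) g i.
  move=> b0 g0; apply: ge_ereal_sup => _ [F [finF _] <-].
  rewrite -ge0_mule_fsumr//; apply: lee_wpmul2l; first by rewrite lee_fin.
  by apply: esum_ge; exists F => //; split.
have {}f0 i : 0 <= f i by exact: f0.
apply/eqP; rewrite eq_le le//=.
have [->|an0] := eqVneq a 0%R.
  by rewrite mul0e; apply: esum_ge0 => i _; rewrite mul0e.
have {an0}a0 : (0 < a)%R by rewrite lt_neqAle eq_sym an0.
have := le a^-1%R (fun i => a%:E * f i).
rewrite invr_ge0 (ltW a0) => /(_ isT).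
have -> : (fun i => a^-1%:E * (a%:E * f i)) = f.
  by apply/funext => i; rewrite muleA -EFinM mulVf ?gt_eqF// mul1e.
move=> /(_ _)/(lee_wpmul2l (_ : 0 <= a%:E)); rewrite muleA -EFinM divff ?gt_eqF// mul1e.
by apply; rewrite ?lee_fin ?ltW// => i; rewrite mule_ge0// lee_fin ltW.
Qed.

Lemma exchange_esum (T U : choiceType) (a : T -> U -> \bar R) :
  (forall i j, 0 <= a i j) ->
  \esum_(i in [set: T]) \esum_(j in [set: U]) a i j =
  \esum_(j in [set: U]) \esum_(i in [set: T]) a i j.
Proof.
move=> a0; rewrite !esum_esum//.
rewrite (reindex_esum [set: U * T] _ (fun p => (p.2, p.1))) //=.
  by congr esum; apply/seteqP; split => // -[x y].
split => //= [[u t] [u' t'] _ _ /= [-> ->]//|[t u] _ /=].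
by exists (u, t).
Qed.

Lemma esum_setX (T U : choiceType) (a : T -> U -> \bar R) :
  (forall i j, 0 <= a i j) ->
  \esum_(p in [set: T * U]) a p.1 p.2 =
  \esum_(i in [set: T]) \esum_(j in [set: U]) a i j.
Proof.
by move=> a0; rewrite esum_esum//; congr esum; apply/seteqP; split => // -[x y].
Qed.

Lemma esum_pred1 (T : choiceType) (k : T) (f : T -> \bar R) : 0 <= f k ->
  \esum_(i in [set: T]) (if i == k then f i else 0) = f k.
Proof.
move=> f0; rewrite -(@esum_set1 R T k f f0) [RHS]esum_mkcond.
by apply: eq_esum => i _; rewrite in_set1.
Qed.

Lemma esum_term_le (T : choiceType) (k : T) (f : T -> \bar R) :
  (forall i, 0 <= f i) -> f k <= \esum_(i in [set: T]) f i.
Proof.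
move=> f0; rewrite -(@esum_set1 R T k f (f0 k)) esum_mkcond.
by apply: le_esum => i _; case: ifPn.
Qed.

Lemma esum_termD (T : choiceType) (k : T) (f : T -> \bar R) :
  (forall i, 0 <= f i) ->
  \esum_(i in [set: T]) f i = f k + \esum_(i in [set i | i != k]) f i.
Proof.
move=> f0; rewrite (esumID [set k])// !setTI esum_set1//; congr (_ + esum _ _).
by apply/seteqP; split => i /= /eqP.
Qed.

(** The differences [b i - a i] are nonnegative and, the sum of [a] being
    finite, sum to at most 0. *)
Lemma esum_eq_pointwise (T : choiceType) (a b : T -> R) :
  (forall i, (0 <= a i)%R) -> (forall i, (a i <= b i)%R) ->
  \esum_(i in [set: T]) (b i)%:E <= \esum_(i in [set: T]) (a i)%:E ->
  \esum_(i in [set: T]) (a i)%:E < +oo -> forall i, a i = b i.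
Proof.
move=> a0 ab ba fa i.
have d0 j : (0 <= b j - a j)%R by rewrite subr_ge0.
have afin : \esum_(i in [set: T]) (a i)%:E \is a fin_num.
  by rewrite ge0_fin_numE//; apply: esum_ge0 => j _; rewrite lee_fin.
move: ba; rewrite (_ : \esum_(i in [set: T]) (b i)%:E =
  \esum_(i in [set: T]) (a i)%:E + \esum_(i in [set: T]) (b i - a i)%:E); last first.
  rewrite -esumD; [|by move=> *; rewrite lee_fin..].
  by apply: eq_esum => j _; rewrite -EFinD addrC subrK.
rewrite -{2}(adde0 (esum _ _)) leeD2lE// => h.
have := le_trans (@esum_term_le T i (fun j => (b j - a j)%:E) _) h.
rewrite lee_fin subr_le0 => /(_ _) bai.
by apply/eqP; rewrite eq_le ab bai// => j; rewrite lee_fin.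
Qed.

(** Tannery's theorem: up to eps/2 the dominating sum is carried by a finite
    set, on which the termwise limits can be added up. *)
Lemma tannery (T : choiceType) (f : nat -> T -> R) (a : T -> R) :
  (forall n i, (0 <= f n i <= a i)%R) ->
  \esum_(i in [set: T]) (a i)%:E < +oo ->
  (forall i, f n i @[n --> \oo] --> (0 : R)%R) ->
  forall e : R, (0 < e)%R ->
  \forall n \near \oo, \esum_(i in [set: T]) (f n i)%:E <= e%:E.
Proof.
move=> fa afin f0 e e0.
have a0 i : (0 <= a i)%R by have /andP[/le_trans] := fa 0%N i; apply.
set S := \esum_(i in _) _ in afin.
have Sfin : S \is a fin_num.
  by rewrite ge0_fin_numE//; apply: esum_ge0 => j _; rewrite lee_fin.
have e2 : (0 < e / 2)%R by rewrite divr_gt0.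
have [_ [F [finF _] <-] SF] := ub_ereal_sup_adherent e2 Sfin.
rewrite -/(esum _ _) -/S in SF.
have FS : \sum_(i \in F) (a i)%:E = \esum_(i in F) (a i)%:E.
  by rewrite -esum_fset// => i _; rewrite lee_fin.
have tail : \esum_(i in ~` F) (a i)%:E <= (e / 2)%:E.
  have : S = \esum_(i in F) (a i)%:E + \esum_(i in ~` F) (a i)%:E.
    by rewrite /S (esumID F) ?setTI// => i _; rewrite lee_fin.
  move: SF; rewrite FS; set x := esum F _; set y := esum _ _ => Sx Sxy.
  move: Sxy Sx Sfin.
  have x0 : 0 <= x by apply: esum_ge0 => j _; rewrite lee_fin.
  have y0 : 0 <= y by apply: esum_ge0 => j _; rewrite lee_fin.
  case: x x0 => [x||]//; case: y y0 => [y||]// y0 x0 -> // + _.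
  by rewrite -EFinD -EFinB lte_fin lee_fin => ?; lra.
have : (\sum_(i <- finmap.enum_fset (fset_set F)) f n i)%R @[n --> \oo] -->
    (\sum_(i <- finmap.enum_fset (fset_set F)) (0 : R))%R.
  by apply: cvg_big => [|i _]; [exact: add_continuous|exact: f0].
rewrite big1// => /cvgrPdist_lt /(_ _ e2).
apply: filterS => n; rewrite sub0r normrN => hn.
rewrite (esumID F) ?setTI; last by move=> i _; rewrite lee_fin; case/andP: (fa n i).
have -> : e%:E = (e / 2)%:E + (e / 2)%:E by rewrite -EFinD -splitr.
apply: leeD.
  rewrite esum_fset//; last by move=> i _; rewrite lee_fin; case/andP: (fa n i).
  rewrite fsumEFin// lee_fin fsbig_finite//; exact: le_trans (ler_norm _) (ltW hn).
apply: le_trans tail; apply: le_esum => i _; rewrite lee_fin.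
by case/andP: (fa n i).
Qed.

End esum_lemmas.

(** * Markov processes with given rates *)

Section ctmc.
Variables (R : realType) (T : countType) (q : T -> T -> R).
Variables (P : R -> T -> T -> R).
Hypothesis CP : is_CTMC q P.
Local Open Scope ereal_scope.

Lemma CTMC_ge0 t i j : (0 <= t)%R -> (0 <= P t i j)%R.
Proof. by move=> /(CTMC_distribution CP i)[]. Qed.

Lemma CTMC_mass t i : (0 <= t)%R -> \esum_(j in [set: T]) (P t i j)%:E = 1.
Proof. by move=> /(CTMC_distribution CP i)[]. Qed.

Lemma CTMC_le1 t i j : (0 <= t)%R -> (P t i j <= 1)%R.
Proof.
move=> t0; rewrite -lee_fin -(CTMC_mass i t0).
by apply: (@esum_term_le _ _ j (fun j => (P t i j)%:E)) => k; rewrite lee_fin CTMC_ge0.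
Qed.

Lemma CTMC_mul_le s t i k j : (0 <= s)%R -> (0 <= t)%R ->
  (P s i k * P t k j <= P (s + t) i j)%R.
Proof.
move=> s0 t0; rewrite -lee_fin (CTMC_Chapman_Kolmogorov CP)//.
apply: (@esum_term_le _ _ k (fun k => (P s i k * P t k j)%:E)) => l.
by rewrite lee_fin mulr_ge0// CTMC_ge0.
Qed.

(** The chain is in [i] at time [n * t] at least when it is there at each of
    the times [t, 2 * t, ...], so that the probability of being away is
    subadditive in time. *)
Lemma CTMC_leave_subadditive n t i : (0 <= t)%R ->
  (1 - P (n%:R * t) i i <= n%:R * (1 - P t i i))%R.
Proof.
move=> t0; elim: n => [|n IH].
  by rewrite !mul0r (CTMC_initial CP) eqxx subrr.
have nt0 : (0 <= n%:R * t)%R by rewrite mulr_ge0.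
have := CTMC_mul_le i i i nt0 t0.
rewrite -natr1 mulrDl mul1r.
have := CTMC_le1 i i nt0; have := CTMC_le1 i i t0.
by move: IH; nra.
Qed.

Lemma cvg_div_succn (t : R) : (fun n => t / n.+1%:R)%R @ \oo --> (0 : R)%R.
Proof. by rewrite -[X in _ --> X](mulr0 t); apply: cvgMr; exact: cvg_harmonic. Qed.

Lemma cvg_small_times (f : R -> R) (l t : R) : (0 < t)%R ->
  f h @[h --> (0:R)^'+] --> l -> f (t / n.+1%:R)%R @[n --> \oo] --> l.
Proof.
move=> t0 /cvg_at_rightP; apply; split; last exact: cvg_div_succn.
by move=> n; rewrite divr_gt0.
Qed.

(** The exit rate is the limit of [(1 - P h i i) / h] along [h = t / n], and by
    subadditivity each of these quotients dominates [(1 - P t i i) / t].  An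
    infinitesimal rate thus yields a bound for all times, with no error term. *)
Lemma CTMC_leave_le t i (e : R) : (0 <= t)%R ->
  \esum_(j in [set j | j != i]) (q i j)%:E = e%:E -> (1 - P t i i <= t * e)%R.
Proof.
rewrite le_eqVlt => /orP[/eqP<- _|t0 ei].
  by rewrite (CTMC_initial CP) eqxx subrr mul0r.
have := CTMC_exit_rate CP (i := i); rewrite ei => /fine_cvg /=.
move=> /(cvg_small_times t0) h.
rewrite mulrC -ler_pdivrMr//.
apply: (cvgr_to_ge h); apply: nearW => n /=.
have n0 : (0 < n.+1%:R :> R)%R by [].
have tn0 : (0 <= t / n.+1%:R)%R by rewrite divr_ge0// ltW.
have := CTMC_leave_subadditive n.+1 i tn0.
rewrite mulrCA divff ?gt_eqF// mulr1 => {}h.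
by rewrite invf_div [leRHS]mulrA ler_pM2r ?invr_gt0// [leRHS]mulrC.
Qed.

Lemma CTMC_rate_ge0 i j : i != j -> (0 <= q i j)%R.
Proof.
move=> ij; have := CTMC_rate CP ij => /(cvg_small_times ltr01) h.
apply: (cvgr_to_ge h); apply: nearW => n /=.
by rewrite divr_ge0// ?CTMC_ge0// divr_ge0.
Qed.

Lemma CTMC_total_push (m : T -> R) t : (forall i, 0 <= m i)%R -> (0 <= t)%R ->
  \esum_(j in [set: T]) \esum_(i in [set: T]) (m i * P t i j)%:E =
  \esum_(i in [set: T]) (m i)%:E.
Proof.
move=> m0 t0; rewrite exchange_esum; last first.
  by move=> j i; rewrite lee_fin mulr_ge0// CTMC_ge0.
apply: eq_esum => i _; under eq_esum do rewrite EFinM.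
rewrite esumZl ?CTMC_mass ?mule1// => j _.
by rewrite lee_fin CTMC_ge0.
Qed.

(** Pushing a finite measure forward preserves its total mass, so an
    inequality between the two that holds at every state is an equality. *)
Lemma CTMC_push_eq (m : T -> R) t : (forall i, 0 <= m i)%R ->
  \esum_(i in [set: T]) (m i)%:E < +oo -> (0 <= t)%R ->
  (forall j, \esum_(i in [set: T]) (m i * P t i j)%:E <= (m j)%:E) \/
  (forall j, (m j)%:E <= \esum_(i in [set: T]) (m i * P t i j)%:E) ->
  forall j, \esum_(i in [set: T]) (m i * P t i j)%:E = (m j)%:E.
Proof.
move=> m0 mfin t0 cmp j.
have mP0 k : 0 <= \esum_(i in [set: T]) (m i * P t i k)%:E.
  by apply: esum_ge0 => i _; rewrite lee_fin mulr_ge0// CTMC_ge0.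
have mPfin k : \esum_(i in [set: T]) (m i * P t i k)%:E \is a fin_num.
  rewrite ge0_fin_numE//; apply: le_lt_trans mfin.
  by apply: le_esum => i _; rewrite lee_fin ler_piMr// CTMC_le1.
pose mP k := fine (\esum_(i in [set: T]) (m i * P t i k)%:E).
have mPE k : \esum_(i in [set: T]) (m i * P t i k)%:E = (mP k)%:E by rewrite fineK.
have tot : \esum_(k in [set: T]) (mP k)%:E = \esum_(i in [set: T]) (m i)%:E.
  by rewrite -(CTMC_total_push m0 t0); apply: eq_esum => k _; rewrite mPE.
rewrite mPE; congr EFin; case: cmp => cmp; [|apply/esym].
  apply: (@esum_eq_pointwise _ _ mP m); rewrite ?tot// => k.
    by rewrite fine_ge0.
  by rewrite -lee_fin -mPE.
by apply: (@esum_eq_pointwise _ _ m mP); rewrite ?tot// => k; rewrite -lee_fin -mPE.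
Qed.

(** [q i j > 0] makes [P t i j > 0] for some small [t], and [m j] is at least
    [m i * P t i j]. *)
Lemma CTMC_positive_spread (m : T -> R) : (forall i, 0 <= m i)%R ->
  (forall t j, (0 <= t)%R ->
    \esum_(i in [set: T]) (m i * P t i j)%:E = (m j)%:E) ->
  forall i j, i != j -> (0 < m i)%R -> (0 < q i j)%R -> (0 < m j)%R.
Proof.
move=> m0 mP i j ij mi qij.
have [t t0 Pt] : exists2 t, (0 < t)%R & (0 < P t i j)%R.
  have /(cvg_small_times ltr01) := CTMC_rate CP ij.
  move=> /cvgr_gt /(_ _ qij)[N _ /(_ N (leqnn N))].
  have N0 : (0 < 1 / N.+1%:R :> R)%R by rewrite divr_gt0.
  by rewrite pmulr_lgt0 ?invr_gt0// => ?; exists (1 / N.+1%:R)%R.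
rewrite -lte_fin -(mP _ j (ltW t0)).
apply: (@lt_le_trans _ _ (m i * P t i j)%:E).
  by rewrite lte_fin mulr_gt0.
apply: (@esum_term_le _ _ i (fun i => (m i * P t i j)%:E)) => k.
by rewrite lee_fin mulr_ge0// CTMC_ge0// ltW.
Qed.

Lemma CTMC_invariantB (m n : T -> R) t j : (forall i, 0 <= m i <= n i)%R ->
  (0 <= t)%R ->
  \esum_(i in [set: T]) (m i * P t i j)%:E = (m j)%:E ->
  \esum_(i in [set: T]) (n i * P t i j)%:E = (n j)%:E ->
  \esum_(i in [set: T]) ((n i - m i) * P t i j)%:E = (n j - m j)%:E.
Proof.
move=> mn t0 mP.
rewrite (_ : \esum_(i in [set: T]) (n i * P t i j)%:E =
  \esum_(i in [set: T]) ((n i - m i) * P t i j)%:E +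
  \esum_(i in [set: T]) (m i * P t i j)%:E); last first.
  rewrite -esumD => [|i _|i _].
  - by apply: eq_esum => i _; rewrite -EFinD -mulrDl subrK.
  - by rewrite lee_fin mulr_ge0 ?CTMC_ge0// subr_ge0; case/andP: (mn i).
  - by rewrite lee_fin mulr_ge0 ?CTMC_ge0//; case/andP: (mn i).
rewrite mP; case: (esum _ _) => [x||]//.
by rewrite -EFinD => -[<-]; rewrite addrK.
Qed.

(** The predicates [A] closed under positive rates express irreducibility.  The
    pointwise minimum [m] of two stationary distributions pushes forward below
    both of them, hence is invariant, and so are the differences with [m].  An
    invariant measure of an irreducible chain vanishes everywhere or nowhere;
    as the two differences are never both positive, one of them is zero, and
    equality of the masses does the rest. *)
Lemma CTMC_stationary_unique (mu nu : T -> R) :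
  (forall A : T -> Prop, (exists i, A i) ->
     (forall i j, i != j -> A i -> (0 < q i j)%R -> A j) -> forall i, A i) ->
  is_stationary P mu -> is_stationary P nu -> forall i, mu i = nu i.
Proof.
move=> irr [[mu0 mu1] muP] [[nu0 nu1] nuP].
pose m i := Num.min (mu i) (nu i).
have m0 i : (0 <= m i)%R by rewrite le_min mu0 nu0.
have mmu i : (m i <= mu i)%R by rewrite ge_min lexx.
have mnu i : (m i <= nu i)%R by rewrite ge_min lexx orbT.
have mfin : \esum_(i in [set: T]) (m i)%:E < +oo.
  rewrite (@le_lt_trans _ _ (\esum_(i in [set: T]) (mu i)%:E)) ?mu1 ?ltry//.
  by rewrite -mu1; apply: le_esum => i _; rewrite lee_fin.
have mP t j : (0 <= t)%R ->
    \esum_(i in [set: T]) (m i * P t i j)%:E = (m j)%:E.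
  move=> t0; move: j; apply: CTMC_push_eq => //; left => j.
  rewrite (_ : m j = Num.min (mu j) (nu j))//; have [_|_] := leP (mu j) (nu j).
    rewrite -(muP t)//; apply: le_esum => i _.
    by rewrite lee_fin ler_wpM2r// CTMC_ge0.
  rewrite -(nuP t)//; apply: le_esum => i _.
  by rewrite lee_fin ler_wpM2r// CTMC_ge0.
have spread (n : T -> R) : (forall i, m i <= n i)%R ->
    (forall t j, (0 <= t)%R ->
      \esum_(i in [set: T]) (n i * P t i j)%:E = (n j)%:E) ->
    (exists i, m i < n i)%R -> forall i, (m i < n i)%R.
  move=> mn nP ex; apply: (irr (fun i => (m i < n i)%R)) => // i j ij.
  rewrite -!(subr_gt0 (m _)).
  apply: (@CTMC_positive_spread (fun k => n k - m k)%R) => //.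
    by move=> k; rewrite subr_ge0.
  by move=> t k t0; apply: CTMC_invariantB; rewrite ?mP ?nP// => l; rewrite m0 mn.
have [mulnu|] := pselect (forall i, mu i <= nu i)%R.
  by apply: esum_eq_pointwise; rewrite ?mu1 ?nu1 ?ltry.
move=> /existsNP[i /negP]; rewrite -ltNge => numu i'; apply/esym; move: i'.
apply: esum_eq_pointwise; rewrite ?mu1 ?nu1 ?ltry// => j.
have : (m j < mu j)%R.
  by apply: spread => //; exists i; rewrite /m gt_min numu orbT.
by rewrite gt_min ltxx => /ltW.
Qed.

(** * Global balance implies stationarity *)

Section balance.
Variables (mu e : T -> R).
Hypothesis mu_dist : is_distribution mu.
Hypothesis exitE : forall i, \esum_(j in [set j | j != i]) (q i j)%:E = (e i)%:E.
Hypothesis exit_fin : \esum_(i in [set: T]) (mu i * e i)%:E < +oo.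
Hypothesis balance : forall j,
  \esum_(i in [set i | i != j]) (mu i * q i j)%:E = (mu j * e j)%:E.

(** Only the amount by which [P h i j] falls short of [h * q i j] is recorded:
    a one-sided estimate is enough because masses are preserved, and it is
    dominated by [q i j] uniformly in [h]. *)
Definition rate_defect h i j : R :=
  if i == j then 0%R else Num.max 0%R (q i j - P h i j / h)%R.

Definition push_defect h : \bar R :=
  \esum_(j in [set: T]) \esum_(i in [set: T]) (h * (mu i * rate_defect h i j))%:E.

Let mu0 i : (0 <= mu i)%R. Proof. by case: mu_dist. Qed.

Lemma rate_defect_ge0 h i j : (0 <= rate_defect h i j)%R.
Proof. by rewrite /rate_defect; case: ifPn => // _; rewrite le_max lexx. Qed.

Let summand_ge0 h i j : (0 < h)%R -> 0 <= (h * (mu i * rate_defect h i j))%:E.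
Proof. by move=> h0; rewrite lee_fin !mulr_ge0 ?rate_defect_ge0// ltW. Qed.

(** One small step loses at most the defect at each state: the fraction of mass
    that stays in [j] is at least [1 - h * e j] and, apart from the defect, the
    inflow is at least [h] times the balanced inflow [mu j * e j]. *)
Lemma push_defectP h j : (0 < h)%R ->
  (mu j)%:E <= \esum_(i in [set: T]) (mu i * P h i j)%:E +
               \esum_(i in [set: T]) (h * (mu i * rate_defect h i j))%:E.
Proof.
move=> h0; have h0' := ltW h0.
rewrite -esumD => [|i _|i _]; last 2 first.
- by rewrite lee_fin mulr_ge0// CTMC_ge0.
- exact: summand_ge0.
rewrite (esum_termD j); last first.
  by move=> i; rewrite adde_ge0 ?summand_ge0// lee_fin mulr_ge0// CTMC_ge0.
have -> : rate_defect h j j = 0%R by rewrite /rate_defect eqxx.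
rewrite !mulr0 adde0.
rewrite [leLHS](_ : _ = (mu j * (1 - h * e j))%:E + (h * (mu j * e j))%:E); last first.
  by rewrite -EFinD; congr EFin; ring.
apply: leeD.
  rewrite lee_fin ler_wpM2l//; have := CTMC_leave_le h0' (exitE j).
  by rewrite !lerBlDr addrC.
rewrite EFinM -balance -esumZl//; last first.
  by move=> i /= ij; rewrite lee_fin mulr_ge0// CTMC_rate_ge0.
apply: le_esum => i /= /negPf ij.
rewrite -EFinM -EFinD lee_fin /rate_defect ij [leLHS]mulrCA [X in (_ <= _ + X)%R]mulrCA -mulrDr.
rewrite ler_wpM2l// -lerBlDl.
rewrite (_ : _ - _ = h * (q i j - P h i j / h))%R; last by field; rewrite gt_eqF.
by rewrite ler_wpM2l// le_max lexx orbT.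
Qed.

(** After a first step, its defect is pushed forward by the other [n] steps, and
    contributes at most its total mass at [j]; the losses therefore add up. *)
Lemma push_defect_iter h n j : (0 < h)%R ->
  (mu j)%:E <= \esum_(i in [set: T]) (mu i * P (n%:R * h) i j)%:E +
               n%:R%:E * push_defect h.
Proof.
move=> h0; have h0' := ltW h0; elim: n => [|n IH].
  rewrite mul0e adde0.
  have := @esum_term_le R T j (fun i => (mu i * P (0%:R * h) i j)%:E).
  rewrite mul0r (CTMC_initial CP) eqxx mulr1; apply => i.
  by rewrite lee_fin mulr_ge0// CTMC_ge0.
have nh0 : (0 <= n%:R * h)%R by rewrite mulr_ge0.
have D0 : 0 <= push_defect h.
  by apply: esum_ge0 => k _; apply: esum_ge0 => i _; exact: summand_ge0.
apply: le_trans IH _.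
rewrite -natr1 EFinD ge0_muleDl ?lee_fin// mul1e [X in _ <= _ + X]addeC addeA leeD2r//.
rewrite mulrDl mul1r.
apply: (@le_trans _ _ (\esum_(i in [set: T]) ((P (n%:R * h) i j)%:E *
   (\esum_(k in [set: T]) (mu k * P h k i)%:E +
    \esum_(k in [set: T]) (h * (mu k * rate_defect h k i))%:E)))).
  apply: le_esum => i _; rewrite mulrC EFinM lee_wpmul2l ?push_defectP//.
  by rewrite lee_fin CTMC_ge0.
have inner0 i : 0 <= \esum_(k in [set: T]) (mu k * P h k i)%:E.
  by apply: esum_ge0 => k _; rewrite lee_fin mulr_ge0// CTMC_ge0.
have inner1 i : 0 <= \esum_(k in [set: T]) (h * (mu k * rate_defect h k i))%:E.
  by apply: esum_ge0 => k _; exact: summand_ge0.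
have Pn0 i : (0 <= P (n%:R * h) i j)%R by rewrite CTMC_ge0.
under eq_esum do rewrite ge0_muleDr//.
rewrite esumD; [|by move=> i _; rewrite mule_ge0// lee_fin..].
apply: leeD; last first.
  apply: le_esum => i _.
  by rewrite -[leRHS]mul1e lee_wpmul2r// lee_fin CTMC_le1.
rewrite (_ : (fun i => _) = fun i => \esum_(k in [set: T])
    (mu k * (P h k i * P (n%:R * h) i j))%:E); last first.
  apply/funext => i; rewrite -esumZl// => [|k _]; last first.
    by rewrite lee_fin mulr_ge0// CTMC_ge0.
  by apply: eq_esum => k _; rewrite -EFinM; congr EFin; ring.
rewrite exchange_esum; last first.
  by move=> i k; rewrite lee_fin !mulr_ge0// CTMC_ge0.
apply: le_esum => k _; rewrite addrC EFinM (CTMC_Chapman_Kolmogorov CP)//.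
rewrite -esumZl// => i _.
by rewrite lee_fin mulr_ge0// CTMC_ge0.
Qed.

(** Tannery's theorem applies to [mu i * rate_defect h i j], which is dominated
    by [mu i * q i j], of finite sum, and tends to 0 with [h] for all [i], [j]. *)
Lemma push_defect_small t : (0 < t)%R -> forall eps : R, (0 < eps)%R ->
  \forall n \near \oo, n.+1%:R%:E * push_defect (t / n.+1%:R) <= eps%:E.
Proof.
move=> t0 eps eps0.
pose a i j := if i == j then 0%R else (mu i * q i j)%R.
pose f n i j := (mu i * rate_defect (t / n.+1%:R) i j)%R.
have n0 n : (0 < n.+1%:R :> R)%R by [].
have tn0 n : (0 < t / n.+1%:R)%R by rewrite divr_gt0.
have a0 i j : (0 <= a i j)%R.
  by rewrite /a; case: ifPn => // ij; rewrite mulr_ge0// CTMC_rate_ge0.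
have f0 n i j : (0 <= f n i j)%R by rewrite mulr_ge0// rate_defect_ge0.
have fa n (p : T * T) : (0 <= f n p.1 p.2 <= a p.1 p.2)%R.
  rewrite f0 /=; rewrite /f /a /rate_defect; case: ifPn => [_|ij]; first by rewrite mulr0.
  rewrite ler_wpM2l// ge_max CTMC_rate_ge0//= lerBlDr lerDl.
  by rewrite divr_ge0 ?CTMC_ge0// ltW.
have afin : \esum_(p in [set: T * T]) (a p.1 p.2)%:E < +oo.
  apply: le_lt_trans exit_fin.
  rewrite (esum_setX (a := fun i j => (a i j)%:E)); last by move=> *; rewrite lee_fin.
  apply: le_esum => i _; rewrite EFinM -exitE -esumZl// => [|j /= ji]; last first.
    by rewrite lee_fin CTMC_rate_ge0// eq_sym.
  rewrite [leRHS]esum_mkcond; apply: le_esum => j _; rewrite mem_setE /a eq_sym.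
  by rewrite unfold_in /=; case: (eqVneq j i) => //= _; rewrite EFinM.
have fcvg (p : T * T) : f n p.1 p.2 @[n --> \oo] --> (0 : R)%R.
  rewrite /f -[X in _ --> X](mulr0 (mu p.1)); apply: cvgMr.
  rewrite /rate_defect; have [_|ij] := eqVneq; first exact: cvg_cst.
  apply: (@squeeze_cvgr _ _ _ _ (fun=> 0%R)
    (fun n => `|q p.1 p.2 - P (t / n.+1%:R) p.1 p.2 / (t / n.+1%:R)|)%R).
  - apply: nearW => n; rewrite le_max lexx/= ge_max normr_ge0/=.
    exact: ler_norm.
  - exact: cvg_cst.
  rewrite -[X in _ --> X](normr0 R) -(subrr (q p.1 p.2)).
  apply: cvg_norm; apply: cvgB; first exact: cvg_cst.
  exact: (cvg_small_times t0 (CTMC_rate CP ij)).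
have et0 : (0 < eps / t)%R by rewrite divr_gt0.
have := tannery fa afin fcvg et0; apply: filterS => n hn.
have -> : n.+1%:R%:E * push_defect (t / n.+1%:R) =
    t%:E * \esum_(p in [set: T * T]) (f n p.1 p.2)%:E.
  rewrite (esum_setX (a := fun i j => (f n i j)%:E)); last by move=> *; rewrite lee_fin.
  rewrite /push_defect [in LHS]exchange_esum => [|j i]; last exact: (summand_ge0 _ _ (tn0 n)).
  rewrite -esumZl// => [|i _]; last by apply: esum_ge0 => j _; exact: (summand_ge0 _ _ (tn0 n)).
  rewrite -esumZl ?(ltW t0)// => [|i _]; last by apply: esum_ge0 => j _; rewrite lee_fin.
  apply: eq_esum => i _.
  rewrite -esumZl// => [|j _]; last exact: (summand_ge0 _ _ (tn0 n)).
  rewrite -esumZl ?(ltW t0)// => [|j _]; last by rewrite lee_fin.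
  apply: eq_esum => j _; rewrite -!EFinM; congr EFin; rewrite /f [RHS]mulrC.
  rewrite [LHS]mulrA [(n.+1%:R * (_ / _))%R]mulrCA divff ?gt_eqF//.
  by rewrite mulr1 mulrC.
have -> : eps%:E = t%:E * (eps / t)%:E.
  by rewrite -EFinM mulrCA divff ?mulr1 ?gt_eqF.
by rewrite lee_wpmul2l// lee_fin ltW.
Qed.

(** Cut [0, t] into [n] steps: the total loss is [n] times the defect of a step
    of length [t / n], which tends to 0.  So [mu] lies below its push-forward,
    and both have mass 1. *)
Lemma CTMC_balance_stationary : is_stationary P mu.
Proof.
split=> // t j; rewrite le_eqVlt => /orP[/eqP<-|t0].
  under eq_esum do rewrite (CTMC_initial CP).
  rewrite -[RHS](@esum_pred1 R T j (fun i => (mu i)%:E)) ?lee_fin//.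
  apply: eq_esum => i _; case: eqVneq => [->|_]; first by rewrite mulr1.
  by rewrite mulr0.
apply: CTMC_push_eq (ltW t0) _ j => //.
  by case: mu_dist => _ ->; rewrite ltry.
right => j; apply/lee_addgt0Pr => eps eps0.
have [N _ /(_ N (leqnn N)) /= hN] := push_defect_small t0 eps0.
have tN0 : (0 < t / N.+1%:R)%R by rewrite divr_gt0.
have := push_defect_iter N.+1 j tN0.
rewrite mulrCA divff ?mulr1 ?gt_eqF// => /le_trans; apply.
exact: leeD2l.
Qed.

End balance.
End ctmc.

(** * Uniformization *)

Section poisson.
Variable R : realType.
Implicit Types x y : R.
Local Open Scope ereal_scope.

Definition pois x (n : nat) : R := (expR (- x) * (x ^+ n / n`!%:R))%R.

Lemma pois_ge0 x n : (0 <= x)%R -> (0 <= pois x n)%R.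
Proof. by move=> x0; rewrite mulr_ge0 ?expR_ge0// divr_ge0// exprn_ge0. Qed.

Lemma esum_pois x : (0 <= x)%R -> \esum_(n in [set: nat]) (pois x n)%:E = 1.
Proof.
move=> x0; rewrite -nneseries_esumT => [|n]; last by rewrite lee_fin pois_ge0.
apply/cvg_lim => //.
rewrite (_ : (fun n => _) = EFin \o (fun n => expR (- x) * series (exp_coeff x) n)%R).
  apply: cvg_EFin; first exact: nearW.
  rewrite -(expR0 R) -(addNr x) expRD; apply: cvgMr.
  exact: is_cvg_series_exp_coeff.
apply/funext => n /=; rewrite sumEFin; congr EFin.
by rewrite /series /= mulr_sumr.
Qed.

Lemma poisD x y N :
  pois (x + y) N = (\sum_(n < N.+1) pois x n * pois y (N - n)%N)%R.
Proof.
rewrite addrC /pois exprDn opprD addrC expRD mulr_suml mulr_sumr; apply: eq_bigr => i _.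
have le_iN : (i <= N)%N by rewrite -ltnS.
rewrite -(bin_fact le_iN) !natrM -mulr_natr; field.
by rewrite !pnatr_eq0 -!lt0n !fact_gt0 bin_gt0 le_iN.
Qed.

(** The sum over pairs [(n, m)] is regrouped along [N = n + m]. *)
Lemma esum_convolution (a b c : nat -> R) :
  (forall n, 0 <= a n)%R -> (forall n, 0 <= b n)%R -> (forall n, 0 <= c n)%R ->
  \esum_(n in [set: nat]) \esum_(m in [set: nat]) (a n * b m * c (n + m)%N)%:E =
  \esum_(N in [set: nat]) ((\sum_(n < N.+1) a n * b (N - n)%N) * c N)%:E.
Proof.
move=> a0 b0 c0.
pose g n N := if (n <= N)%N then (a n * b (N - n)%N * c N)%:E else 0.
have g0 n N : 0 <= g n N.
  by rewrite /g; case: ifPn => // _; rewrite lee_fin !mulr_ge0.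
transitivity (\esum_(n in [set: nat]) \esum_(N in [set: nat]) g n N).
  apply: eq_esum => n _.
  transitivity (\esum_(N in [set N | (n <= N)%N]) (a n * b (N - n)%N * c N)%:E).
    rewrite [RHS](reindex_esum [set: nat] _ (addn n)).
      by apply: eq_esum => m _; rewrite addKn.
    split => [m _ /=|m m' _ _ /addnI//|N /= nN]; first exact: leq_addr.
    by exists (N - n)%N => //; rewrite subnKC.
  by rewrite [LHS]esum_mkcond; apply: eq_esum => N _; rewrite /g mem_setE unfold_in.
rewrite exchange_esum//; apply: eq_esum => N _.
transitivity (\esum_(n in `I_N.+1) (a n * b (N - n)%N * c N)%:E).
  by rewrite [RHS]esum_mkcond; apply: eq_esum => n _; rewrite /g mem_setE unfold_in.
rewrite esum_fset//; last by move=> n _; rewrite lee_fin !mulr_ge0.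
rewrite fsumEFin//; congr EFin.
by rewrite -fsbig_ord mulr_suml.
Qed.

Lemma esum_nat_recl (f : nat -> \bar R) : (forall n, 0 <= f n) ->
  \esum_(n in [set: nat]) f n = f 0%N + \esum_(n in [set: nat]) f n.+1.
Proof.
move=> f0; rewrite (esum_termD 0%N)//; congr +%E.
apply: (reindex_esum [set: nat] _ S).
by split => // [m n _ _ []//|[//|n] _]; exists n.
Qed.

Lemma pois_tail x : (0 <= x)%R ->
  \esum_(n in [set: nat]) (pois x n.+2)%:E <= (x ^+ 2)%:E.
Proof.
move=> x0; have := esum_pois x0.
have p0 n : 0 <= (pois x n)%:E by rewrite lee_fin pois_ge0.
rewrite esum_nat_recl// esum_nat_recl//.
case: (esum _ _) => [r||]//; rewrite -!EFinD lee_fin => -[].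
rewrite /pois fact0 expr0 divr1 mulr1 factS fact0 mul1n expr1 divr1.
have := expR_ge1Dx (- x)%R; nra.
Qed.

Lemma expRN_bounds x : (0 <= x)%R ->
  [/\ 1 - x <= expR (- x), expR (- x) <= 1 & expR (- x) <= 1 - x + x ^+ 2]%R.
Proof.
move=> x0; have := expR_ge1Dx (- x)%R.
have e0 := expR_gt0 (- x)%R; have := expR_ge1Dx x.
have : (expR x * expR (- x) = 1)%R by rewrite -expRD subrr expR0.
move: e0; move: (expR x) (expR (- x)) => u v ? ? ? ?; split; nra.
Qed.

End poisson.

Section uniformization.
Variables (R : realType) (T : countType) (K : T -> T -> R) (L : R).
Hypothesis K0 : forall i j, 0 <= K i j.
Hypothesis K1 : forall i, (\esum_(j in [set: T]) (K i j)%:E = 1)%E.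
Hypothesis L0 : 0 < L.
Local Open Scope ereal_scope.

(** The [n]-step transition probabilities of the chain with kernel [K]. *)
Fixpoint jump (n : nat) (i j : T) : R :=
  if n is n'.+1 then fine (\esum_(k in [set: T]) (K i k * jump n' k j)%:E)
  else (i == j)%:R.

Lemma jump_ge0 n i j : (0 <= jump n i j)%R.
Proof.
case: n => [|n] /=; first by rewrite ler0n.
suff h m : forall i j, (0 <= jump m i j)%R.
  by apply: fine_ge0; apply: esum_ge0 => k _; rewrite lee_fin mulr_ge0.
elim: m => [|m IH] {}i {}j /=; first by rewrite ler0n.
by apply: fine_ge0; apply: esum_ge0 => k _; rewrite lee_fin mulr_ge0.
Qed.

Lemma esum_kron i (f : T -> R) : (0 <= f i)%R ->
  \esum_(j in [set: T]) ((i == j)%:R * f j)%:E = (f i)%:E.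
Proof.
move=> f0; rewrite -[RHS](@esum_pred1 R T i (fun j => (f j)%:E))//.
apply: eq_esum => j _; rewrite eq_sym.
by case: eqP; rewrite ?mul1r ?mul0r.
Qed.

Lemma jump_le1_succ n i j : (forall k, jump n k j <= 1)%R ->
  (jump n.+1 i j)%:E = \esum_(k in [set: T]) (K i k * jump n k j)%:E.
Proof.
move=> le1 /=; rewrite fineK// ge0_fin_numE; last first.
  by apply: esum_ge0 => k _; rewrite lee_fin mulr_ge0// jump_ge0.
apply: (@le_lt_trans _ _ 1); last exact: ltry.
rewrite -(K1 i); apply: le_esum => k _.
by rewrite lee_fin ler_piMr.
Qed.

Lemma jump_mass n i : \esum_(j in [set: T]) (jump n i j)%:E = 1.
Proof.
elim: n i => [|n IH] i.
  rewrite -[RHS](@esum_kron i (fun=> 1%R))//.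
  by apply: eq_esum => j _ /=; rewrite mulr1.
have le1 k j : (jump n k j <= 1)%R.
  rewrite -lee_fin -(IH k); apply: (@esum_term_le _ _ j (fun j => (jump n k j)%:E)) => l.
  by rewrite lee_fin jump_ge0.
under eq_esum do rewrite jump_le1_succ//.
rewrite exchange_esum => [|j k]; last by rewrite lee_fin mulr_ge0// jump_ge0.
rewrite -[RHS](K1 i); apply: eq_esum => k _; under eq_esum do rewrite EFinM.
by rewrite esumZl ?IH ?mule1// => j _; rewrite lee_fin jump_ge0.
Qed.

Lemma jump_le1 n i j : (jump n i j <= 1)%R.
Proof.
rewrite -lee_fin -(jump_mass n i).
apply: (@esum_term_le _ _ j (fun j => (jump n i j)%:E)) => l.
by rewrite lee_fin jump_ge0.
Qed.

Lemma jumpS n i j :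
  (jump n.+1 i j)%:E = \esum_(k in [set: T]) (K i k * jump n k j)%:E.
Proof. by rewrite jump_le1_succ// => k; exact: jump_le1. Qed.

Lemma jumpD m n i j :
  (jump (m + n) i j)%:E = \esum_(k in [set: T]) (jump m i k * jump n k j)%:E.
Proof.
elim: m i => [|m IH] i.
  by rewrite add0n /= (@esum_kron i (fun k => jump n k j)) ?jump_ge0.
rewrite addSn jumpS.
transitivity (\esum_(l in [set: T]) \esum_(k in [set: T])
    (K i l * (jump m l k * jump n k j))%:E).
  apply: eq_esum => l _; rewrite EFinM IH -esumZl// => k _.
  by rewrite lee_fin mulr_ge0 ?jump_ge0.
rewrite exchange_esum => [|l k]; last by rewrite lee_fin !mulr_ge0 ?jump_ge0.
apply: eq_esum => k _; rewrite mulrC EFinM jumpS -esumZl ?jump_ge0//.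
  by apply: eq_esum => l _; rewrite -EFinM; congr EFin; ring.
by move=> l _; rewrite lee_fin mulr_ge0 ?jump_ge0.
Qed.

Lemma jump1 i j : jump 1 i j = K i j.
Proof.
have := jumpS 0 i j; rewrite (_ : esum _ _ = (K i j)%:E); first by case.
rewrite -(@esum_kron j (K i))//; apply: eq_esum => k _ /=.
by rewrite mulrC eq_sym.
Qed.

(** The chain that jumps according to [K] at the times of a Poisson process of
    rate [L]. *)
Definition uniformized (t : R) (i j : T) : R :=
  fine (\esum_(n in [set: nat]) (pois (L * t) n * jump n i j)%:E).

Lemma uniformizedE t i j : (0 <= t)%R -> (uniformized t i j)%:E =
  \esum_(n in [set: nat]) (pois (L * t) n * jump n i j)%:E.
Proof.
move=> t0; have x0 : (0 <= L * t)%R by rewrite mulr_ge0// ltW.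
rewrite fineK// ge0_fin_numE; last first.
  by apply: esum_ge0 => k _; rewrite lee_fin mulr_ge0// ?jump_ge0// pois_ge0.
apply: (@le_lt_trans _ _ 1); last exact: ltry.
rewrite -(esum_pois x0); apply: le_esum => k _.
by rewrite lee_fin ler_piMr// ?jump_le1// pois_ge0.
Qed.

Lemma uniformized_ge0 t i j : (0 <= t)%R -> (0 <= uniformized t i j)%R.
Proof.
move=> t0; rewrite -lee_fin uniformizedE//; apply: esum_ge0 => n _.
by rewrite lee_fin mulr_ge0 ?jump_ge0// pois_ge0// mulr_ge0// ltW.
Qed.

Lemma uniformized_mass t i : (0 <= t)%R ->
  \esum_(j in [set: T]) (uniformized t i j)%:E = 1.
Proof.
move=> t0; have x0 : (0 <= L * t)%R by rewrite mulr_ge0// ltW.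
under eq_esum do rewrite uniformizedE//.
rewrite exchange_esum => [|j n]; last by rewrite lee_fin mulr_ge0 ?jump_ge0// pois_ge0.
rewrite -(esum_pois x0); apply: eq_esum => n _; under eq_esum do rewrite EFinM.
by rewrite esumZl ?pois_ge0 ?jump_mass ?mule1// => j _; rewrite lee_fin jump_ge0.
Qed.

Lemma uniformized_Chapman_Kolmogorov s t i j : (0 <= s)%R -> (0 <= t)%R ->
  (uniformized (s + t) i j)%:E =
  \esum_(k in [set: T]) (uniformized s i k * uniformized t k j)%:E.
Proof.
move=> s0 t0.
have x0 : (0 <= L * s)%R by rewrite mulr_ge0// ltW.
have y0 : (0 <= L * t)%R by rewrite mulr_ge0// ltW.
rewrite uniformizedE ?addr_ge0// mulrDr.
under eq_esum do rewrite poisD.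
rewrite -esum_convolution; [|by move=> n; rewrite ?pois_ge0 ?jump_ge0..].
have pj0 x n k l : (0 <= x)%R -> 0 <= (pois x n * jump n k l)%:E.
  by move=> ?; rewrite lee_fin mulr_ge0 ?jump_ge0// pois_ge0.
transitivity (\esum_(n in [set: nat]) \esum_(m in [set: nat]) \esum_(k in [set: T])
   ((pois (L * s) n * jump n i k) * (pois (L * t) m * jump m k j))%:E).
  apply: eq_esum => n _; apply: eq_esum => m _.
  rewrite EFinM jumpD -esumZl; first last.
  - by move=> k _; rewrite lee_fin mulr_ge0 ?jump_ge0.
  - by rewrite (mulr_ge0 (pois_ge0 _ x0) (pois_ge0 _ y0)).
  by apply: eq_esum => k _; rewrite -EFinM; congr EFin; ring.
have inner0 n m k : 0 <=
    ((pois (L * s) n * jump n i k) * (pois (L * t) m * jump m k j))%:E.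
  by rewrite EFinM; apply: mule_ge0; exact: pj0.
under eq_esum do rewrite exchange_esum//.
rewrite exchange_esum => [|n k]; last exact: esum_ge0.
apply: eq_esum => k _.
have -> : (uniformized s i k * uniformized t k j)%:E =
    (uniformized t k j)%:E * (uniformized s i k)%:E by rewrite -EFinM mulrC.
rewrite [(uniformized s i k)%:E]uniformizedE// -esumZl ?uniformized_ge0// => [|n _]; last exact: pj0.
apply: eq_esum => n _; rewrite muleC uniformizedE// -esumZl => [||m _]; last exact: pj0.
  by apply: eq_esum => m _; rewrite -EFinM.
by rewrite mulr_ge0 ?jump_ge0// pois_ge0.
Qed.

(** The first two Poisson terms give the value of the chain to first order; the
    others have total weight at most [(L * t) ^+ 2]. *)
Lemma uniformized_small t i j : (0 <= t)%R ->
  (`|uniformized t i j - (i == j)%:R - L * t * (K i j - (i == j)%:R)|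
     <= 3 * (L * t) ^+ 2)%R.
Proof.
move=> t0; have x0 : (0 <= L * t)%R by rewrite mulr_ge0// ltW.
have pj0 n : 0 <= (pois (L * t) n * jump n i j)%:E.
  by rewrite lee_fin mulr_ge0 ?jump_ge0// pois_ge0.
have := uniformizedE i j t0; rewrite esum_nat_recl// esum_nat_recl//.
have : 0 <= \esum_(n in [set: nat]) (pois (L * t) n.+2 * jump n.+2 i j)%:E.
  exact: esum_ge0.
have : \esum_(n in [set: nat]) (pois (L * t) n.+2 * jump n.+2 i j)%:E <=
    ((L * t) ^+ 2)%:E.
  apply: le_trans (pois_tail x0); apply: le_esum => n _.
  by rewrite lee_fin ler_piMr ?jump_le1// pois_ge0.
case: (esum _ _) => [r||]//; rewrite !lee_fin -!EFinD jump1 [jump 0 i j]/=.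
move=> rle r0 []; rewrite /pois fact0 expr0 divr1 mulr1 factS fact0 mul1n expr1 divr1 => ->.
have kij : (K i j <= 1)%R by rewrite -jump1 jump_le1.
have := K0 i j; move: kij; move: (K i j) => k k1 k0.
have [] := expRN_bounds x0.
move: x0 rle; move: (L * t)%R (expR _) => x u x0 rle h1 h2 h3.
have xk0 : (0 <= x * (k * (1 - u)))%R by rewrite !mulr_ge0// subr_ge0.
have xk1 : (x * (k * (1 - u)) <= x ^+ 2)%R.
  by rewrite expr2 ler_wpM2l//; nra.
by rewrite ler_norml; case: (i == j) => /=; apply/andP; split; lra.
Qed.

Lemma uniformized_derivative i j :
  ((uniformized h i j - (i == j)%:R) / h)%R @[h --> (0:R)^'+] -->
    (L * (K i j - (i == j)%:R))%R.
Proof.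
apply/cvgrPdist_le => eps eps0.
have c0 : (0 < eps / (3 * L ^+ 2))%R by rewrite divr_gt0// mulr_gt0// exprn_gt0.
near=> h.
have h0 : (0 < h)%R by near: h; exact: nbhs_right_gt.
have hc : (h < eps / (3 * L ^+ 2))%R by near: h; exact: nbhs_right_lt.
have := uniformized_small i j (ltW h0).
set D := (uniformized h i j - _)%R; set k := (K i j - _)%R => small.
have -> : (L * k - D / h = - ((D - L * h * k) / h))%R by field; rewrite gt_eqF.
rewrite normrN normrM (gtr0_norm (_ : 0 < h^-1)%R) ?invr_gt0//.
rewrite ler_pdivrMr//; apply: le_trans small _.
move: hc; rewrite ltr_pdivlMr ?mulr_gt0 ?exprn_gt0// => hc.
have -> : (3 * (L * h) ^+ 2 = h * (3 * L ^+ 2) * h)%R by ring.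
by rewrite ler_wpM2r ?(ltW h0)// ltW.
Unshelve. all: by end_near. Qed.

Lemma uniformized_is_CTMC (q : T -> T -> R) :
  (forall i j, i != j -> q i j = L * K i j)%R -> is_CTMC q uniformized.
Proof.
move=> qK; split.
- move=> t i t0; split; last exact: uniformized_mass.
  by move=> j; exact: uniformized_ge0.
- move=> i j; have := @uniformized_small 0%R i j (lexx _).
  rewrite mulr0 mul0r subr0 expr0n mulr0 normr_le0 subr_eq0 => /eqP ->.
  by [].
- exact: uniformized_Chapman_Kolmogorov.
- move=> i j ij; have := @uniformized_derivative i j.
  rewrite (negPf ij) subr0 -qK//.
  by under eq_fun do rewrite subr0.
- move=> i.
  have -> : \esum_(j in [set j | j != i]) (q i j)%:E = (L * (1 - K i i))%:E.
    rewrite EFinM (_ : (1 - K i i)%:E = \esum_(j in [set j | j != i]) (K i j)%:E).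
      rewrite -esumZl ?(ltW L0)//; last by move=> j _; rewrite lee_fin.
      by apply: eq_esum => j /= ji; rewrite -EFinM qK// eq_sym.
    have := K1 i; rewrite (esum_termD i) => [|j]; last by rewrite lee_fin.
    by case: (esum _ _) => [r||]//; rewrite -EFinD => -[<-]; rewrite addrAC subrr add0r.
  apply: cvg_EFin; first exact: nearW.
  have -> : (L * (1 - K i i) = - (L * (K i i - 1)))%R by ring.
  rewrite (_ : fine \o _ = fun h => - ((uniformized h i i - 1) / h))%R.
    by apply: cvgN; have := @uniformized_derivative i i; rewrite eqxx.
  by apply/funext => h /=; rewrite -mulNr opprB.
Qed.

End uniformization.

(** The kernel jumps from [i] to [j] with probability [q i j / L] and holds
    with the remaining probability, which [e i <= L] makes nonnegative. *)
Lemma bounded_rates_CTMC (R : realType) (T : countType) (q : T -> T -> R)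
    (e : T -> R) (L : R) :
  (forall i j, i != j -> 0 <= q i j) ->
  (forall i, \esum_(j in [set j | j != i]) (q i j)%:E = (e i)%:E)%E ->
  0 < L -> (forall i, e i <= L) ->
  exists P, is_CTMC q P.
Proof.
move=> q0 qe L0 eL.
pose K i j := if i == j then 1 - e i / L else q i j / L.
have K0 i j : 0 <= K i j.
  rewrite /K; case: ifPn => [_|ij]; last by rewrite divr_ge0 ?q0// ltW.
  by rewrite subr_ge0 ler_pdivrMr// mul1r.
exists (uniformized K L); apply: uniformized_is_CTMC => //.
- move=> i; rewrite (esum_termD i) => [|j]; last by rewrite lee_fin.
  rewrite (_ : esum _ _ = (e i / L)%:E); first by rewrite /K eqxx -EFinD subrK.
  rewrite mulrC EFinM -qe -esumZl ?invr_ge0 ?(ltW L0)//; last first.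
    by move=> j /= ji; rewrite lee_fin q0// eq_sym.
  apply: eq_esum => j /= /negPf ji.
  by rewrite /K eq_sym ji mulrC EFinM.
- move=> i j ij; rewrite /K (negPf ij) mulrC divfK// gt_eqF//.
Qed.

(** * The weights and the modified arrival rates *)

Lemma esum_series (R : realType) (u : nat -> R) (l : R) : (forall n, 0 <= u n) ->
  series u @ \oo --> l -> (\esum_(n in [set: nat]) (u n)%:E = l%:E)%E.
Proof.
move=> u0 ul; rewrite -nneseries_esumT => [|n]; last by rewrite lee_fin.
apply/cvg_lim => //.
rewrite (_ : (fun n => _) = EFin \o series u); first by apply: cvg_EFin => //; exact: nearW.
by apply/funext => n /=; rewrite sumEFin.
Qed.

Lemma esum_expr (R : realType) (z : R) : 0 < z -> z < 1 ->
  (\esum_(n in [set: nat]) (z ^+ n)%:E = ((1 - z)^-1)%:E)%E.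
Proof.
move=> z_gt0 hz1.
apply: esum_series => [n|]; first by rewrite exprn_ge0// ltW.
have := @cvg_geometric_series R 1 z; rewrite ger0_norm ?(ltW z_gt0)// => /(_ hz1).
rewrite div1r; apply: cvg_trans; apply: near_eq_cvg; apply: nearW => n.
by rewrite /series/=; apply: eq_bigr => i _; rewrite mul1r.
Qed.
Section tandem.
Variables (R : realType) (lam mu1 mu2 z : R) (w lamt : nat -> R).
Hypotheses (hlam : 0 < lam) (hlam2 : lam < mu2) (hmu : mu2 < mu1).
Hypotheses (hz : lam / mu2 <= z) (hz1 : z < 1).
Hypothesis hw0 : w 0%N = 1.
Hypothesis hw1 : mu1 * w 1%N = (lam + mu2 * (1 - z)) * z.
Hypothesis hw : forall k : nat, (1 <= k)%N ->
  mu1 * w k.+1 = (lam + mu1 + mu2 * (1 - z)) * z * w k - lam * z * w k.-1.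
Hypothesis hlamt0 : lamt 0%N = mu2 * z.
Hypothesis hlamt : forall i : nat, (1 <= i)%N ->
  lamt i = lamt i.-1 * (w i.-1 / w i) + mu2 * z - mu1.

Let mu2_gt0 : 0 < mu2. Proof. exact: lt_trans hlam2. Qed.
Let mu1_gt0 : 0 < mu1. Proof. exact: lt_trans hmu. Qed.
Let lam_le : lam <= mu2 * z. Proof. by move: hz; rewrite ler_pdivrMr// mulrC. Qed.
Let z_gt0 : 0 < z. Proof. by rewrite -(pmulr_rgt0 z mu2_gt0); exact: lt_le_trans lam_le. Qed.
Let mu2z_lt : mu2 * z < mu1. Proof. by move: mu2_gt0 hmu hz1 z_gt0; nra. Qed.

(** The recurrence reads [r' = g r] for the ratio [r] of consecutive weights,
    with [g] increasing.  The interval from [w 1] to 1 is mapped into itself: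
    [g (w 1) >= w 1] amounts to [lam <= mu2 * z] and [g 1 <= 1] to
    [mu2 * z <= mu1]. *)
Lemma weight_ratio k : [/\ 0 < w k, w 1 * w k <= w k.+1 & w k.+1 <= w k].
Proof.
have w1_gt0 : 0 < w 1.
  by rewrite -(pmulr_rgt0 _ mu1_gt0) hw1 mulr_gt0// addr_gt0// mulr_gt0// subr_gt0.
have w1_ge : lam <= mu1 * w 1.
  have := mulr_ge0 (_ : 0 <= 1 - z) (_ : 0 <= mu2 * z - lam).
  by rewrite hw1 !subr_ge0 (ltW hz1) lam_le => /(_ isT isT); lra.
elim: k => [|k [wk IHl IHu]].
  rewrite hw0 mulr1; split => //; rewrite -(ler_pM2l mu1_gt0) hw1 mulr1.
  have := mulr_ge0 (ltW z_gt0) (_ : 0 <= mu2 * z - lam).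
  by rewrite subr_ge0 lam_le => /(_ isT); move: mu2z_lt; lra.
have wk1 : 0 < w k.+1 by apply: lt_le_trans IHl; rewrite mulr_gt0.
split=> //; rewrite -(ler_pM2l mu1_gt0) (hw (ltn0Sn k)) /=.
  have h1 : z * lam * w k <= z * (mu1 * w 1) * w k.
    by rewrite ler_pM2r// ler_pM2l.
  have h2 : z * mu1 * (w 1 * w k) <= z * mu1 * w k.+1.
    by rewrite ler_pM2l// mulr_gt0.
  rewrite [leLHS]mulrA hw1; lra.
have h1 : lam * z * w k.+1 <= lam * z * w k by rewrite ler_pM2l// mulr_gt0.
have h2 : 0 <= (1 - z) * (mu1 - mu2 * z) * w k.+1.
  by rewrite !mulr_ge0 ?subr_ge0// ltW.
lra.
Qed.

Lemma weight_gt0 k : 0 < w k. Proof. by have [] := weight_ratio k. Qed.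

(** Solves the recursion of the modified rates in terms of the weights, which
    turns the bounds on the ratios into bounds on the rates. *)
Lemma lamt_weight i : (1 - z) * (lamt i * w i) = mu1 * w i.+1 - lam * z * w i.
Proof.
elim: i => [|i IH]; first by rewrite hw0 hlamt0 hw1; ring.
rewrite (hw (ltn0Sn i)) (hlamt (ltn0Sn i)) /=.
transitivity ((1 - z) * (lamt i * w i) + (1 - z) * (mu2 * z - mu1) * w i.+1).
  by field; rewrite gt_eqF// weight_gt0.
by rewrite IH; ring.
Qed.

Lemma lamt_bounds i : 0 < lamt i /\ lamt i <= mu1 / (1 - z).
Proof.
have [wi lo hi] := weight_ratio i.
have z1 : 0 < 1 - z by rewrite subr_gt0.
have e := lamt_weight i; split.
  rewrite -(pmulr_lgt0 _ wi) -(pmulr_rgt0 _ z1) e.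
  have := ler_wpM2l (ltW mu1_gt0) lo; rewrite mulrA hw1.
  have : 0 < mu2 * (1 - z) * z * w i by rewrite !mulr_gt0.
  lra.
rewrite ler_pdivlMr// -(ler_pM2r wi) mulrAC mulrC e.
have := ler_wpM2l (ltW mu1_gt0) hi.
have : 0 < lam * z * w i by rewrite !mulr_gt0.
lra.
Qed.

(** The recursion of [lamt] makes [lamt i * w i] telescope. *)
Lemma weight_partial_sum n :
  (mu1 - mu2 * z) * \sum_(0 <= j < n.+1) w j = mu1 - lamt n * w n.
Proof.
elim: n => [|n IH]; first by rewrite big_nat1 hw0 hlamt0 !mulr1.
rewrite big_nat_recr//= mulrDr IH (hlamt (ltn0Sn n))/=.
by field; rewrite gt_eqF// weight_gt0.
Qed.

Let S := mu1 / (mu1 - mu2 * z).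
Let d_gt0 : 0 < mu1 - mu2 * z. Proof. by rewrite subr_gt0. Qed.
Let S_gt0 : 0 < S. Proof. by rewrite divr_gt0. Qed.

(** The partial sums are bounded, so the weights tend to 0; as the rates are
    bounded, the correction [lamt n * w n] to the sum disappears in the limit. *)
Lemma series_weight_cvg : series w @ \oo --> S.
Proof.
have cw : cvgn (series w).
  apply: nondecreasing_is_cvgn.
    by apply: nondecreasing_series => n _ _; exact/ltW/weight_gt0.
  exists S => _ [n _ <-]; apply: (@le_trans _ _ (series w n.+1)).
    by rewrite seriesSr lerDl ltW// weight_gt0.
  rewrite /S ler_pdivlMr// mulrC weight_partial_sum gerBl.
  by rewrite mulr_ge0// ltW ?weight_gt0//; have [] := lamt_bounds n.
have w0 := cvg_series_cvg_0 cw.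
rewrite -(cvg_shiftS (series w)).
rewrite (_ : (fun n => _) = fun n => S - lamt n * w n / (mu1 - mu2 * z)); last first.
  apply/funext => n; rewrite /S -mulrBl -weight_partial_sum mulrAC divff ?mul1r//.
  by rewrite gt_eqF.
suff h : (fun n => lamt n * w n) @ \oo --> (0 : R).
  have : (fun n => S - lamt n * w n / (mu1 - mu2 * z)) @ \oo -->
      S - 0 / (mu1 - mu2 * z) by apply: cvgB; [exact: cvg_cst|exact: cvgMl].
  by rewrite mul0r subr0.
apply: (@squeeze_cvgr _ _ _ _ (fun=> 0) (fun n => mu1 / (1 - z) * w n)).
- apply: nearW => n; have [l0 l1] := lamt_bounds n; have wn := weight_gt0 n.
  by apply/andP; split; [rewrite mulr_ge0// ltW|rewrite ler_wpM2r// ltW].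
- exact: cvg_cst.
- have : (fun n => mu1 / (1 - z) * w n) @ \oo --> mu1 / (1 - z) * 0 by apply: cvgMr.
  by rewrite mulr0.
Qed.

Lemma esum_weight : (\esum_(j in [set: nat]) (w j)%:E = S%:E)%E.
Proof.
by apply: esum_series series_weight_cvg => n; exact/ltW/weight_gt0.
Qed.

End tandem.

(** * The transition rates of the tandem network *)

Lemma esum_offdiag (R : realType) (T : choiceType) (f : T -> R) (x : T) :
  (forall y, 0 <= f y) -> f x = 0 ->
  (\esum_(y in [set y | y != x]) (f y)%:E = \esum_(y in [set: T]) (f y)%:E)%E.
Proof.
by move=> f0 fx; rewrite [RHS](esum_termD x) ?fx ?add0e// => y; rewrite lee_fin.
Qed.

Lemma esum_guarded_pred1 (R : realType) (T : choiceType) (f : T -> R) (b : bool) (x : T) :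
  (forall y, 0 <= f y) ->
  (\esum_(y in [set: T]) (f y *+ (b && (y == x)))%:E = (f x *+ b)%:E)%E.
Proof.
move=> f0; case: b => /=; last by rewrite esum1.
rewrite -[RHS](@esum_pred1 R T x (fun y => (f y)%:E)) ?lee_fin//.
by apply: eq_esum => y _; case: eqP.
Qed.

Section tandem_generator.
Variables (R : realType) (lam mu1 mu2 : R) (lamt : nat -> R).
Hypotheses (lam_ge0 : 0 <= lam) (mu1_ge0 : 0 <= mu1) (mu2_ge0 : 0 <= mu2).
Hypothesis lamt_ge0 : forall j, 0 <= lamt j.
Let q := tandem_rate lam mu1 mu2 lamt.

Definition arrival (x : nat * nat) : R := if x.1 == 0%N then lamt x.2 else lam.

Definition exit_rate (x : nat * nat) : R :=
  arrival x + mu1 *+ (0 < x.2)%N + mu2 *+ (0 < x.1)%N.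

Lemma arrival_ge0 x : 0 <= arrival x.
Proof. by rewrite /arrival; case: ifP. Qed.

Lemma tandem_rateE x y : q x y =
  arrival x *+ (y == (x.1, x.2.+1))
  + mu1 *+ ((0 < x.2)%N && (y == (x.1.+1, x.2.-1)))
  + mu2 *+ ((0 < x.1)%N && (y == (x.1.-1, x.2))).
Proof. by case: x. Qed.

Lemma tandem_rate_ge0 x y : 0 <= q x y.
Proof. by rewrite tandem_rateE !addr_ge0// mulrn_wge0// arrival_ge0. Qed.

Lemma tandem_rate_diag x : q x x = 0.
Proof.
case: x => k j; rewrite tandem_rateE /= !xpair_eqE.
rewrite (ltn_eqF (ltnSn j)) (ltn_eqF (ltnSn k)) andbF /= andbF !add0r.
by case: k => //= k; rewrite (gtn_eqF (ltnSn k)).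
Qed.

Lemma tandem_exit_rate x :
  (\esum_(y in [set y | y != x]) (q x y)%:E = (exit_rate x)%:E)%E.
Proof.
rewrite esum_offdiag => [|y|]; [|exact: tandem_rate_ge0|exact: tandem_rate_diag].
under eq_esum do rewrite tandem_rateE !EFinD.
rewrite !esumD => [|*|*|*|*]; rewrite -?EFinD ?lee_fin ?addr_ge0 ?mulrn_wge0 ?arrival_ge0//.
rewrite (esum_guarded_pred1 (f := fun=> arrival x) true) => [|_]; last exact: arrival_ge0.
by rewrite !(esum_guarded_pred1 (f := fun=> _)).
Qed.

(** Every transition is inverted: the guard on the source and the equation for
    the target become a guard on the target and an equation for the source. *)
Lemma tandem_inflow (m : nat * nat -> R) k j : (forall x, 0 <= m x) ->
  (\esum_(x in [set x | x != (k, j)]) (m x * q x (k, j))%:E =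
   ((m (k, j.-1) * arrival (k, j.-1)) *+ (0 < j)%N
    + (m (k.-1, j.+1) * mu1) *+ (0 < k)%N
    + m (k.+1, j) * mu2)%:E)%E.
Proof.
move=> m0; rewrite (@esum_offdiag _ _ (fun x => m x * q x (k, j))) => [|y|]; last first.
- by rewrite tandem_rate_diag mulr0.
- by rewrite mulr_ge0// tandem_rate_ge0.
have E x : m x * q x (k, j) =
    m x * arrival x *+ ((0 < j)%N && (x == (k, j.-1)))
    + m x * mu1 *+ ((0 < k)%N && (x == (k.-1, j.+1)))
    + m x * mu2 *+ (true && (x == (k.+1, j))).
  rewrite tandem_rateE !mulrDr !mulrnAr; case: x => a b /=; rewrite !xpair_eqE.
  congr (_ *+ nat_of_bool _ + _ *+ nat_of_bool _ + _ *+ nat_of_bool _).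
  - by case: j => [|j]/=; rewrite ?andbF// [k == a]eq_sym eqSS [j == b]eq_sym.
  - case: k b => [|k] [|b] //=; rewrite ?andbF//.
    by rewrite !eqSS [k == a]eq_sym [j == b]eq_sym.
  - by case: a => [|a] //=; rewrite [k == a]eq_sym eqSS [j == b]eq_sym.
under eq_esum do rewrite E !EFinD.
have ma x : 0 <= m x * arrival x by rewrite mulr_ge0// arrival_ge0.
rewrite !esumD => [|*|*|*|*]; rewrite -?EFinD ?lee_fin ?addr_ge0 ?mulrn_wge0 ?mulr_ge0 ?arrival_ge0//.
rewrite (@esum_guarded_pred1 _ _ (fun x => m x * arrival x))//.
rewrite (@esum_guarded_pred1 _ _ (fun x => m x * mu1)) => [|*]; last exact: mulr_ge0.
by rewrite (@esum_guarded_pred1 _ _ (fun x => m x * mu2)) => [|*]; last exact: mulr_ge0.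
Qed.

End tandem_generator.

(** Services empty both queues from any state; from the empty state, arrivals
    while queue 2 is empty followed by services at queue 1 lead to any state. *)
Lemma tandem_irreducible (R : realType) (lam mu1 mu2 : R) (lamt : nat -> R)
    (A : nat * nat -> Prop) :
  0 < lam -> 0 < mu1 -> 0 < mu2 -> (forall j, 0 < lamt j) ->
  (exists x, A x) ->
  (forall x y, x != y -> A x -> 0 < tandem_rate lam mu1 mu2 lamt x y -> A y) ->
  forall x, A x.
Proof.
move=> lam0 mu10 mu20 lamt0 [[k0 j0] A0] closed.
have a0 x : 0 < arrival lam lamt x by rewrite /arrival; case: ifP.
have up k j : A (k, j) -> A (k, j.+1).
  move=> Ax; apply: (closed (k, j)) => //; first by rewrite xpair_eqE (ltn_eqF (ltnSn j)) andbF.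
  by rewrite tandem_rateE eqxx mulr1n -addrA ltr_pwDl// addr_ge0// mulrn_wge0// ltW.
have serve1 k j : A (k, j.+1) -> A (k.+1, j).
  move=> Ax; apply: (closed (k, j.+1)) => //; first by rewrite xpair_eqE (ltn_eqF (ltnSn k)).
  by rewrite tandem_rateE /= eqxx mulr1n addrAC ltr_wpDl// addr_ge0// mulrn_wge0// ltW.
have serve2 k j : A (k.+1, j) -> A (k, j).
  move=> Ax; apply: (closed (k.+1, j)) => //; first by rewrite xpair_eqE (gtn_eqF (ltnSn k)).
  by rewrite tandem_rateE /= eqxx mulr1n ltr_wpDl// addr_ge0// mulrn_wge0// ltW.
have down2 k j : A (k, j) -> A (0%N, j) by elim: k => // k IH /serve2.
have down1 j : A (0%N, j) -> A (0%N, 0%N) by elim: j => // j IH /serve1/serve2.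
have Az := down1 _ (down2 _ _ A0).
have A1 j : A (0%N, j) by elim: j => // j /up.
have A2 k j : A (k, j) by elim: k j => // k IH j; apply: serve1; exact: IH.
by case.
Qed.

(** * The stationary distribution *)

Theorem mainTheorem4 (R : realType) (lam mu1 mu2 z : R) (w lamt : nat -> R)
  (hlam : 0 < lam) (hlam2 : lam < mu2) (hmu : mu2 < mu1)
  (hz : lam / mu2 <= z) (hz1 : z < 1)
  (hw0 : w 0%N = 1)
  (hw1 : mu1 * w 1%N = (lam + mu2 * (1 - z)) * z)
  (hw : forall k : nat, (1 <= k)%N ->
     mu1 * w k.+1 =
       (lam + mu1 + mu2 * (1 - z)) * z * w k - lam * z * w k.-1)
  (hlamt0 : lamt 0%N = mu2 * z)
  (hlamt : forall i : nat, (1 <= i)%N ->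
     lamt i = lamt i.-1 * (w i.-1 / w i) + mu2 * z - mu1) :
  (* the weights and the modified arrival rates are meaningful, and there is a
     Markov process with these transition rates *)
  (forall i : nat, w i != 0) /\
  (forall i : nat, 0 <= lamt i) /\
  (exists P : R -> nat * nat -> nat * nat -> R,
     is_CTMC (tandem_rate lam mu1 mu2 lamt) P) /\
  exists c : R,
    forall P : R -> nat * nat -> nat * nat -> R,
      is_CTMC (tandem_rate lam mu1 mu2 lamt) P ->
      (forall pi : nat * nat -> R,
         is_stationary P pi <->
         (forall n j : nat, pi (n, j) = c * z ^+ n * w j)) /\
      (forall pi : nat * nat -> R,
         is_stationary P pi -> has_decay_rate (queue2_marginal pi) z).
Proof.
have z0 : 0 < z by apply: lt_le_trans hz; rewrite divr_gt0// (lt_trans hlam).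
have mu20 : 0 < mu2 by exact: lt_trans hlam2.
have mu10 : 0 < mu1 by exact: lt_trans hmu.
have z1 : 0 < 1 - z by rewrite subr_gt0.
have w_gt0 := weight_gt0 hlam hlam2 hmu hz hz1 hw0 hw1 hw.
have lamtB := lamt_bounds hlam hlam2 hmu hz hz1 hw0 hw1 hw hlamt0 hlamt.
have lamt_gt0 j : 0 < lamt j by case: (lamtB j).
have lamt_ge0 j : 0 <= lamt j := ltW (lamt_gt0 j).
have exitE := @tandem_exit_rate _ _ _ _ _ (ltW hlam) (ltW mu10) (ltW mu20) lamt_ge0.
pose L := mu1 / (1 - z) + lam + mu1 + mu2.
have L0 : 0 < L by rewrite !addr_gt0// divr_gt0.
have exit_le x : exit_rate lam mu1 mu2 lamt x <= L.
  have arr_le : arrival lam lamt x <= mu1 / (1 - z) + lam.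
    rewrite /arrival; case: ifP => _; last by rewrite lerDr divr_ge0 ?ltW.
    by case: (lamtB x.2) => _ h; rewrite (le_trans h)// lerDl ltW.
  by rewrite !lerD//; [case: ltnP|case: ltnP]; rewrite ?mulr1n ?mulr0n// ltW.
split; first by move=> i; rewrite gt_eqF.
split; first exact: lamt_ge0.
split.
  apply: (bounded_rates_CTMC _ exitE L0 exit_le) => x y _.
  by rewrite tandem_rate_ge0// ltW.
pose S := mu1 / (mu1 - mu2 * z).
have S0 : 0 < S.
  rewrite divr_gt0// subr_gt0; apply: lt_trans hmu.
  by rewrite gtr_pMr.
have sumw := esum_weight hlam hlam2 hmu hz hz1 hw0 hw1 hw hlamt0 hlamt.
rewrite -/S in sumw.
(* The product of the geometric sum 1 / (1 - z) and the sum S of the weights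
   is to be normalized. *)
pose c := (1 - z) / S; have c0 : 0 < c by rewrite divr_gt0.
exists c => P CP.
pose mu (x : nat * nat) := c * z ^+ x.1 * w x.2.
have mu0 x : 0 <= mu x by apply/ltW/mulr_gt0 => //; rewrite mulr_gt0// exprn_gt0.
have marginal n : (\esum_(j in [set: nat]) (mu (n, j))%:E = (c * z ^+ n * S)%:E)%E.
  rewrite EFinM -sumw -esumZl; first by apply: eq_esum.
    by rewrite mulr_ge0 ?exprn_ge0 ?(ltW c0) ?(ltW z0).
  by move=> j _; rewrite lee_fin ltW.
have mu_dist : is_distribution mu.
  split=> //; rewrite (eq_esum (b := fun x => (c * z ^+ x.1 * w x.2)%:E))//.
  rewrite (esum_setX (a := fun n j => (c * z ^+ n * w j)%:E)); last first.
    by move=> n j; exact: (mu0 (n, j)).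
  under eq_esum do rewrite marginal mulrAC EFinM.
  rewrite esumZl ?(mulr_ge0 (ltW c0) (ltW S0))//; last first.
    by move=> n _; rewrite lee_fin exprn_ge0// ltW.
  rewrite (esum_expr z0 hz1) -EFinM /c divfK ?gt_eqF// divff// gt_eqF//.
(* State by state, the balance equations are the recursions of the weights
   (queue 2 nonempty) and of the modified rates (queue 2 empty). *)
have balance y : (\esum_(x in [set x | x != y])
    (mu x * tandem_rate lam mu1 mu2 lamt x y)%:E =
    (mu y * exit_rate lam mu1 mu2 lamt y)%:E)%E.
  case: y => k j; rewrite tandem_inflow// ?(ltW hlam) ?(ltW mu10) ?(ltW mu20)//.
  congr EFin; rewrite /mu /exit_rate /arrival.
  case: k j => [|k] [|j] /=; rewrite ?mulr1n ?mulr0n ?addr0 ?add0r.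
  - by rewrite hlamt0; ring.
  - have -> : lamt j.+1 = lamt j * (w j / w j.+1) + mu2 * z - mu1 by rewrite hlamt.
    by field; rewrite gt_eqF.
  - rewrite [X in X + _ = _](_ : _ = c * z ^+ k * (mu1 * w 1)); last by ring.
    by rewrite hw1 hw0 !exprS; ring.
  - rewrite [_ * w j.+2 * mu1](_ : _ = c * z ^+ k * (mu1 * w j.+2)); last by ring.
    by rewrite hw//= !exprS; ring.
have mu_stat : is_stationary P mu.
  apply: (CTMC_balance_stationary CP mu_dist exitE _ balance).
  apply: (@le_lt_trans _ _ (\esum_(x in [set: nat * nat]) (mu x * L)%:E)%E).
    by apply: le_esum => x _; rewrite lee_fin ler_wpM2l.
  under eq_esum do rewrite mulrC EFinM.
  rewrite esumZl ?(ltW L0)//; last by move=> x _; rewrite lee_fin.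
  by case: mu_dist => _ ->; rewrite mule1 ltry.
have stat_mu pi : is_stationary P pi -> forall x, pi x = mu x.
  move=> pi_stat; apply: (CTMC_stationary_unique CP) => // A.
  exact: tandem_irreducible.
split=> pi; first split.
- by move=> /stat_mu pi_mu n j; rewrite pi_mu.
- move=> pi_mu; rewrite (_ : pi = mu)//.
  by apply/funext => -[n j]; rewrite pi_mu.
- move=> /stat_mu/funext ->.
  have mE n : queue2_marginal mu n = c * z ^+ n * S by rewrite /queue2_marginal marginal.
  have m0 n : 0 < queue2_marginal mu n.
    by rewrite mE mulr_gt0// mulr_gt0// exprn_gt0.
  split=> //; rewrite (_ : (fun n => _) = fun=> z); first exact: cvg_cst.
  apply/funext => n.
  have -> : queue2_marginal mu n.+1 = z * queue2_marginal mu n by rewrite !mE exprS; ring.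
  by rewrite mulfK// gt_eqF.
Qed.
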